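(* Let $G$ be a finite planar graph with no two intersecting triangles and such that every triangle of $G$ is adjacent to at most one $4$-cycle. Then $\mathrm{mad}(G)<4$.
   Context: A triangle is a $3$-cycle. Two cycles of a graph are adjacent if they share a common edge, and intersecting if they have at least one common vertex. The maximum average degree is $\mathrm{mad}(G)=\max\{2|E(H)|/|V(H)| : H \text{ a subgraph of } G\}$. *)

(* Defs.v *)
From Stdlib Require Import Reals.
From mathcomp Require Import all_boot.

Set Implicit Arguments.
Unset Strict Implicit.
Unset Printing Implicit Defensive.

(* A finite simple graph is a symmetric irreflexive relation [e : rel T] on a
   finType [T].  Edges are the 2-element vertex sets [set x; y] with [e x y]. *)

Section Graph.
Variable T : finType.
Variable e : rel T.

Definition plane := (R * R)%type.

Definition cont_path (p : R -> plane) : Prop :=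
  forall t, continuity_pt (fun s => fst (p s)) t /\
            continuity_pt (fun s => snd (p s)) t.

Definition in01 (t : R) : Prop := Rle R0 t /\ Rle t R1.
Definition int01 (t : R) : Prop := Rlt R0 t /\ Rlt t R1.

Definition plane_embedding (pos : T -> plane) (arc : T -> T -> R -> plane) : Prop :=
  injective pos /\
  forall x y, e x y ->
    cont_path (arc x y) /\
    arc x y R0 = pos x /\
    arc x y R1 = pos y /\
    (forall t, arc y x t = arc x y (Rminus R1 t)) /\
    (forall s t, in01 s -> in01 t -> arc x y s = arc x y t -> s = t) /\
    (forall t w, int01 t -> arc x y t <> pos w) /\
    (forall u v s t, e u v -> [set x; y] != [set u; v] ->
        int01 s -> in01 t -> arc x y s <> arc u v t).

Definition planar : Prop := exists pos arc, plane_embedding pos arc.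

Definition is_triangle (C : {set {set T}}) : Prop :=
  exists x y z : T,
    [&& uniq [:: x; y; z], e x y, e y z & e z x] /\
    C = [set [set x; y]; [set y; z]; [set z; x]].

Definition is_4cycle (C : {set {set T}}) : Prop :=
  exists a b c d : T,
    [&& uniq [:: a; b; c; d], e a b, e b c, e c d & e d a] /\
    C = [set [set a; b]; [set b; c]; [set c; d]; [set d; a]].

Definition adjacent_cycles (C D : {set {set T}}) : Prop := C :&: D != set0.
Definition intersecting_cycles (C D : {set {set T}}) : Prop :=
  cover C :&: cover D != set0.

Definition edge_set : {set {set T}} :=
  [set [set x; y] | x in T, y in T & e x y].

(* mad(G) < k : every subgraph H = (S, F) with S nonempty satisfies
   2|F|/|S| < k, i.e. 2|F| < k|S|. *)
Definition mad_lt (k : nat) : Prop :=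
  forall (S : {set T}) (F : {set {set T}}),
    0 < #|S| -> F \subset edge_set -> (forall f, f \in F -> f \subset S) ->
    2 * #|F| < k * #|S|.

End Graph.

(* Main.v *)
Require Import Defs.
From Stdlib Require Import Reals ZArith Lra Lia Classical ClassicalEpsilon.
From Coquelicot Require Compactness.
From mathcomp Require Import all_boot fingroup perm ssralg zmodp matrix mxalgebra.
From mathcomp Require Import ssrZ zify.
Import GRing.Theory.

Set Implicit Arguments.
Unset Strict Implicit.
Unset Printing Implicit Defensive.

(** The stronger bound |F| <= 2|S| - 2 is proved by induction on |S|.  It is
    inherited across any cut with at most two edges, so the graph may be assumed
    3-edge-connected.

    By compactness, a plane embedding makes the graph a minor of the square
    grid: boxes around the vertices, joined by lattice walks.  Turning left
    along the resulting grid subgraph and recording only one marked edge per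
    edge of the graph yields a face permutation of the darts.  For an even edge
    set z, the parity of the crossings of a ray with z is constant along each
    face and changes exactly across z; hence the cycle space over F_2 embeds in
    the functions on faces modulo constants, which gives the half
    |faces| >= |F| - |S| + 2 of Euler's formula without the Jordan curve
    theorem.

    A face of length at least 5 gives 1/2 across each edge it shares with a
    triangular face.  Two consecutive edges of a face never both border a
    triangle, and at most one edge of a triangular face borders a 4-face; any
    exception would exhibit a two-edge cut at a vertex.  Thus the average face
    length is at least 4, and |F| <= 2|S| - 4. *)

(** * Lattice paths *)

Definition pt := (Z * Z)%type.

(* A direction is a pair (horizontal?, positive?). *)
Definition dir := (bool * bool)%type.
Definition ldart := (pt * dir)%type.

Definition lhead (d : ldart) : pt :=
  let v := if d.2.2 then 1%Z else (-1)%Z in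
  if d.2.1 then (Z.add d.1.1 v, d.1.2) else (d.1.1, Z.add d.1.2 v).

Definition lrev (d : ldart) : ldart := (lhead d, (d.2.1, ~~ d.2.2)).

Fixpoint chain (p : pt) (ds : seq ldart) (q : pt) : Prop :=
  if ds is d :: ds' then d.1 = p /\ chain (lhead d) ds' q else p = q.

Definition pts (p : pt) (ds : seq ldart) : seq pt := p :: map lhead ds.

Definition in_box (c : pt) (r : Z) (p : pt) : bool :=
  (Z.abs (p.1 - c.1) <=? r)%Z && (Z.abs (p.2 - c.2) <=? r)%Z.

Lemma in_boxP (c : pt) (r : Z) (p : pt) :
  reflect ((Z.abs (p.1 - c.1) <= r)%Z /\ (Z.abs (p.2 - c.2) <= r)%Z)
          (in_box c r p).
Proof.
apply: (iffP andP) => -[/Z.leb_le h1 /Z.leb_le h2]; split => //; exact/Z.leb_le.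
Qed.

Lemma lheadE (p q : pt) (k : dir) : (p.1 = q.1 /\
    (p.2 + (if k.2 then 1 else -1) = q.2)%Z /\ k.1 = false) \/
    (p.2 = q.2 /\ (p.1 + (if k.2 then 1 else -1) = q.1)%Z /\ k.1 = true) ->
  lhead (p, k) = q.
Proof.
by case: p q k => [a b] [a' b'] [[] s] [] /= [-> [<- //]].
Qed.

Lemma lrevK : involutive lrev.
Proof.
by case=> -[a b] [[] []]; rewrite /lrev /lhead /=; congr (_, _, _); lia.
Qed.

Lemma lhead_rev d : lhead (lrev d) = d.1.
Proof. by rewrite -{2}(lrevK d). Qed.

Lemma chain_cat p q r s t : chain p s q -> chain q t r -> chain p (s ++ t) r.
Proof. by elim: s p => [|d s ih] p /= => [->//|[-> /ih h] /h]. Qed.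

Lemma chain_last p s q : chain p s q -> q \in pts p s.
Proof.
elim: s p => [|d s ih] p /= => [->|[_ /ih]]; rewrite !inE ?eqxx //.
by move=> /orP [/eqP->|->]; rewrite ?eqxx ?orbT.
Qed.

Lemma chain_tail p s q d : chain p s q -> d \in s -> d.1 \in pts p s.
Proof.
elim: s p => [|d' s ih] p //= [e /ih {}ih].
rewrite !inE => /orP [/eqP->|/ih]; first by rewrite e eqxx.
by rewrite inE => ->; rewrite orbT.
Qed.

Lemma mem_pts_cat p q s t x : chain p s q ->
  (x \in pts p (s ++ t)) = (x \in pts p s) || (x \in pts q t).
Proof.
move=> h; rewrite !inE map_cat mem_cat.
case: (eqVneq x q) (chain_last h) => [->|_ _]; rewrite ?inE /=.
  by case/orP=> ->; rewrite ?orbT.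
by rewrite -!orbA.
Qed.

Definition rev_chain (s : seq ldart) := rev (map lrev s).

Lemma chain_rev p s q : chain p s q ->
  chain q (rev_chain s) p /\ pts q (rev_chain s) =i pts p s.
Proof.
rewrite /rev_chain; elim: s p => [|d s ih] p /= => [->//|[e /ih [h1 h2]]].
rewrite rev_cons -cats1; split.
  by apply: chain_cat h1 _; rewrite /= lhead_rev.
move=> x; rewrite (mem_pts_cat _ _ h1) h2 !inE lhead_rev e.
by case: (x == p); case: (x == lhead d); case: (x \in _).
Qed.

(** Induction on the $L^1$ distance to [c]: every other point [p] of the box has a neighbour in the
    box that is closer to [c]. *)
Lemma box_chain (c p : pt) (r : Z) : in_box c r p ->
  exists2 s, chain c s p & {in pts c s, forall x, in_box c r x}.
Proof.
have [n] := ubnP (Z.to_nat (Z.abs (p.1 - c.1) + Z.abs (p.2 - c.2))).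
elim: n p => // n ih p hn hp.
have bc : in_box c r c.
  by apply/in_boxP; move/in_boxP: hp; lia.
case: (eqVneq p c) => [->|ne].
  by exists [::] => // x; rewrite !inE => /eqP->.
have [q [k [hq hk hd]]] : exists q k, [/\ in_box c r q, lhead (q, k) = p &
    (Z.abs (q.1 - c.1) + Z.abs (q.2 - c.2) < Z.abs (p.1 - c.1) + Z.abs (p.2 - c.2))%Z].
  case: p c ne hp {hn ih bc} => [a b] [a' b'] ne /in_boxP /= hp.
  case: (Z.lt_trichotomy a a') => [h|[h|h]].
  - exists (a + 1, b)%Z, (true, false);
      split => /=; [apply/in_boxP => /=; lia| by apply: lheadE => /=; lia | lia].
  - case: (Z.lt_trichotomy b b') => [h'|[h'|h']].
    + exists (a, b + 1)%Z, (false, false);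
      split => /=; [apply/in_boxP => /=; lia| by apply: lheadE => /=; lia | lia].
    + by move: ne; rewrite h h' eqxx.
    + exists (a, b - 1)%Z, (false, true);
      split => /=; [apply/in_boxP => /=; lia| by apply: lheadE => /=; lia | lia].
  - exists (a - 1, b)%Z, (true, true);
      split => /=; [apply/in_boxP => /=; lia| by apply: lheadE => /=; lia | lia].
have [|s h1 h2] := ih q _ hq.
  by move/ltP: hn => hn; apply/ltP; lia.
exists (s ++ [:: (q, k)]); first by apply: chain_cat h1 _; rewrite /= hk.
move=> x; rewrite (mem_pts_cat _ _ h1) => /orP [/h2//|].
by rewrite !inE hk => /orP [] /eqP->.
Qed.

(* Cut the walk at its first visit to Y, and before that at its last visit to X. *)
Lemma chain_trim (X Y : pred pt) p s q : chain p s q -> X p -> Y q ->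
  (forall x, X x -> ~~ Y x) ->
  exists p' s' m, [/\ chain p' s' m.1, X p', Y (lhead m),
    (forall x, x \in map lhead s' -> ~~ X x && ~~ Y x) &
    {subset map lhead s' <= pts p s}].
Proof.
move=> + + + XY.
(* The start may also be [p] itself without [X p]: a walk that has not yet met [X] keeps its first
   point, so that a further dart can be put in front. *)
have main : chain p s q -> Y q -> Y p \/ exists p' s' m,
    [/\ chain p' s' m.1, X p' \/ p' = p, Y (lhead m),
      (forall x, x \in map lhead s' -> ~~ X x && ~~ Y x) &
      {subset map lhead s' <= pts p s}].
  elim: s p => [|d s ih] p /=; first by move=> ->; left.
  move=> [e] /ih h /h {h} [h|h]; right.
    by exists p, [::], d; split => //=; right.
  case: h => [p' [s' [m [h1 h2 h3 h4 h5]]]].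
  have [h2'|h2'] : X p' \/ ~~ X p' /\ p' = lhead d.
    by case: h2 => [|->]; [left|case: (boolP (X (lhead d))); [left|right]].
    exists p', s', m; split => //; first by left.
    by move=> x /h5; rewrite !inE => ->; rewrite orbT.
  have {}e2 := h2'.2; rewrite e2 in h1 h2'; have nX := h2'.1.
  case: (boolP (Y (lhead d))) => Yd.
    by exists p, [::], d; split => //=; right.
  exists p, (d :: s'), m; split => //=; first by right.
    by move=> x; rewrite inE => /orP [/eqP->|/h4//]; rewrite nX.
  move=> x; rewrite inE => /orP [/eqP->|/h5]; rewrite !inE ?eqxx ?orbT //.
  by move=> ->; rewrite orbT.
move=> h Xp Yq; case: (main h Yq) => [Yp|[p' [s' [m' [h1 h2 h3 h4 h5]]]]].
  by have := XY _ Xp; rewrite Yp.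
by exists p', s', m'; split => //; case: h2 => // ->.
Qed.

(** * Discretising a plane embedding *)

Section Topology.
Local Open Scope R_scope.

Definition near (eps : R) (p q : plane) : Prop :=
  Rabs (fst p - fst q) < eps /\ Rabs (snd p - snd q) < eps.

Lemma cont_path_near (p : R -> plane) (t eps : R) : cont_path p -> 0 < eps ->
  exists2 eta, 0 < eta & forall s, Rabs (s - t) < eta -> near eps (p s) (p t).
Proof.
move=> cp e0.
have h (f : R -> R) : continuity_pt f t ->
    exists2 eta, 0 < eta & forall s, Rabs (s - t) < eta -> Rabs (f s - f t) < eps.
  move=> cf; have [eta [h1 h2]] := cf eps e0; exists eta => // s hs.
  case: (Req_dec t s) => [<-|ne]; first by rewrite Rminus_diag Rabs_R0.
  by apply: h2.
have [e1 p1 h1] := h _ (cp t).1; have [e2 p2 h2] := h _ (cp t).2.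
exists (Rmin e1 e2); first exact: Rmin_glb_lt.
move=> s hs; split; [apply: h1|apply: h2];
  apply: Rlt_le_trans hs _; [exact: Rmin_l|exact: Rmin_r].
Qed.

(** A Lebesgue number argument: every pair [(s, t)] has a radius within which either [U] persists,
    being open, or the two paths stay apart by continuity. Compactness of the unit square makes the
    radius uniform. *)
Lemma compact_separation (p q : R -> plane) (U : R -> Prop) :
  cont_path p -> cont_path q ->
  (forall s, U s -> exists2 eta, 0 < eta & forall s', Rabs (s' - s) < eta -> U s') ->
  (forall s t, in01 s -> in01 t -> p s = q t -> U s) ->
  exists2 d, 0 < d &
    forall s t, in01 s -> in01 t -> near d (p s) (q t) -> U s.
Proof.
move=> cp cq oU hU.
have loc s t : exists d : posreal, in01 s -> in01 t -> forall s' t',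
    Rabs (s' - s) < d -> Rabs (t' - t) < d -> near d (p s') (q t') -> U s'.
  case: (classic (in01 s /\ in01 t)) => [[is0 it]|n]; last first.
    by exists (mkposreal 1 Rlt_0_1) => a b; case: n.
  case: (classic (p s = q t)) => [/hU h|ne].
    have [d d0 hd] := oU _ (h is0 it).
    by exists (mkposreal d d0) => _ _ s' t' /= /hd.
  (* The factor 3 leaves one [m] for moving [s], one for moving [t], and one for the assumed
     nearness. *)
  have [m m0 hm] : exists2 m, 0 < m & ~ near (3 * m) (p s) (q t).
    apply: NNPP => hn; apply: ne.
    have z x y : (forall m, 0 < m -> Rabs (x - y) < 3 * m) -> x = y.
      move=> h; apply: NNPP => nxy.
      have a0 : 0 < Rabs (x - y) by apply: Rabs_pos_lt; lra.
      by have := h (Rabs (x - y) / 3) ltac:(lra); lra.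
    have hh m : 0 < m -> near (3 * m) (p s) (q t).
      by move=> m0; apply: NNPP => k; apply: hn; exists m.
    rewrite (surjective_pairing (p s)) (surjective_pairing (q t)).
    by congr pair; apply: z => m /hh [].
  have [d1 p1 h1] := cont_path_near s cp m0.
  have [d2 p2 h2] := cont_path_near t cq m0.
  have d0 : 0 < Rmin m (Rmin d1 d2) by do 2![apply: Rmin_glb_lt => //].
  exists (mkposreal _ d0) => _ _ s' t' /= hs ht [n1 n2]; case: hm.
  have l1 := Rmin_l m (Rmin d1 d2); have l2 := Rmin_r m (Rmin d1 d2).
  have l3 := Rmin_l d1 d2; have l4 := Rmin_r d1 d2.
  have [a1 a2] := h1 s' ltac:(lra); have [b1 b2] := h2 t' ltac:(lra).
  by split; move: n1 n2 a1 a2 b1 b2; split_Rabs; lra.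
pose dl s t := proj1_sig (constructive_indefinite_description _ (loc s t)).
have [d hd] := Compactness.compactness_value_2d 0 1 0 1 dl.
exists d; first exact: cond_pos.
(* Compactness provides a nearby pair [(u, v)] only under a double negation, so the goal is first
   turned into [False]. *)
move=> s t hs ht hn; apply: NNPP => nU; apply: (hd s t hs ht).
move=> [u [v [hu [hv [h1 [h2 h3]]]]]]; apply: nU.
rewrite /dl in h1 h2 h3.
case: (constructive_indefinite_description _ (loc u v)) h1 h2 h3 => x hx /= h1 h2 h3.
by apply: (hx hu hv s t h1 h2); case: hn => n1 n2; split; lra.
Qed.

Lemma finite_pos_min (I : finType) (P : I -> R -> Prop) :
  (forall i d d', 0 < d' -> d' <= d -> P i d -> P i d') ->
  (forall i, exists2 d, 0 < d & P i d) -> exists2 d, 0 < d & forall i, P i d.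
Proof.
move=> mono h.
have [d d0 hd] : exists2 d, 0 < d & forall i, i \in enum I -> P i d.
  elim: (enum I) => [|i s [d d0 ih]]; first by exists 1 => //; lra.
  have [d1 p1 h1] := h i; have m0 : 0 < Rmin d d1 by apply: Rmin_glb_lt.
  exists (Rmin d d1) => // j; rewrite inE => /orP [/eqP->|/ih hj].
    by apply: mono h1 => //; exact: Rmin_r.
  by apply: mono hj => //; exact: Rmin_l.
by exists d => // i; apply: hd; rewrite mem_enum.
Qed.

Definition floor_pt (M : R) (p : plane) : pt :=
  (Int_part (M * fst p), Int_part (M * snd p)).

Lemma Int_part_bounds x : IZR (Int_part x) <= x < IZR (Int_part x) + 1.
Proof. by have [] := base_Int_part x; lra. Qed.

Lemma Int_part_close x y : Rabs (x - y) < 1 ->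
  (Z.abs (Int_part x - Int_part y) <= 1)%Z.
Proof.
move=> h; have hx := Int_part_bounds x; have hy := Int_part_bounds y.
have h1 : (Int_part x < Int_part y + 2)%Z.
  by apply: lt_IZR; rewrite plus_IZR; move: h; split_Rabs; lra.
have h2 : (Int_part y < Int_part x + 2)%Z.
  by apply: lt_IZR; rewrite plus_IZR; move: h; split_Rabs; lra.
by lia.
Qed.

(** The tolerance 2 is 1 for rounding plus 1 for the box in which consecutive samples get joined. *)
Definition near_path (M : R) (p : R -> plane) (x : pt) : Prop :=
  exists2 t, in01 t &
    Rabs (IZR x.1 - M * fst (p t)) <= 2 /\ Rabs (IZR x.2 - M * snd (p t)) <= 2.

Lemma box_near_path M p t x : in01 t -> in_box (floor_pt M (p t)) 1 x ->
  near_path M p x.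
Proof.
move=> it /in_boxP; case: x => a b [] /= h1 h2; exists t => //=.
have H c y : (Z.abs (c - Int_part y) <= 1)%Z -> Rabs (IZR c - y) <= 2.
  move=> h; have hy := Int_part_bounds y.
  have /IZR_le k1 : (c <= Int_part y + 1)%Z by lia.
  have /IZR_le k2 : (Int_part y - 1 <= c)%Z by lia.
  by move: k1 k2; rewrite plus_IZR minus_IZR; split_Rabs; lra.
by split; apply: H.
Qed.

Lemma unif_cont (M : R) (p : R -> plane) : 0 < M -> cont_path p ->
  exists2 eta, 0 < eta & forall s t, in01 s -> in01 t -> Rabs (s - t) < eta ->
    near (/ M) (p s) (p t).
Proof.
move=> M0 cp.
have H (f : R -> R) : continuity f -> exists2 eta, 0 < eta &
    forall s t, in01 s -> in01 t -> Rabs (s - t) < eta -> Rabs (f s - f t) < / M.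
  move=> cf.
  have [eta h] := Heine f _ (compact_P3 0 1) (fun x _ => cf x)
    (mkposreal _ (Rinv_0_lt_compat _ M0)).
  by exists eta; [exact: cond_pos|exact: h].
have [e1 p1 h1] := H (fun s => fst (p s)) (fun t => (cp t).1).
have [e2 p2 h2] := H (fun s => snd (p s)) (fun t => (cp t).2).
exists (Rmin e1 e2); first exact: Rmin_glb_lt.
have l1 := Rmin_l e1 e2; have l2 := Rmin_r e1 e2.
by move=> s t is0 it hst; split; [apply: h1|apply: h2] => //; lra.
Qed.

(** By uniform continuity, consecutive samples differ by less than one lattice unit after scaling by
    [M]. Their roundings then lie in a box of radius 1 and are joined inside it. *)
Lemma sampled_chain (M : R) (p : R -> plane) : 0 < M -> cont_path p ->
  exists2 s, chain (floor_pt M (p 0)) s (floor_pt M (p 1)) &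
    forall x, x \in pts (floor_pt M (p 0)) s -> near_path M p x.
Proof.
move=> M0 cp; have [eta eta0 hu] := unif_cont M0 cp.
have [N [N1 N0]] := archimed_cor1 eta eta0.
have Nr : 0 < INR N by apply: lt_0_INR.
have it k : (k <= N)%N -> in01 (INR k / INR N).
  move=> /leP /le_INR h; have k0 := pos_INR k; split.
    by apply: Rmult_le_pos => //; apply/Rlt_le/Rinv_0_lt_compat.
  by apply: (Rmult_le_reg_r (INR N)) => //; rewrite /Rdiv Rmult_assoc Rinv_l; lra.
have main k : (k <= N)%N ->
    exists2 s, chain (floor_pt M (p 0)) s (floor_pt M (p (INR k / INR N))) &
    forall x, x \in pts (floor_pt M (p 0)) s -> near_path M p x.
  elim: k => [_|k ih hk].
    rewrite /Rdiv Rmult_0_l; exists [::] => // x; rewrite inE => /eqP->.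
    apply: (@box_near_path M p 0); first by split; lra.
    by apply/in_boxP; lia.
  have [s hs hn] := ih (ltnW hk).
  set a := INR k / INR N in hs *; set b := INR k.+1 / INR N.
  have ia : in01 a by apply/it/ltnW.
  have ib : in01 b by apply/it.
  have hab : Rabs (b - a) < eta.
    have -> : b - a = / INR N by rewrite /a /b S_INR; field; lra.
    by rewrite Rabs_pos_eq //; apply/Rlt_le/Rinv_0_lt_compat.
  have [n1 n2] := hu b a ib ia hab.
  have sc x y : Rabs (x - y) < / M -> Rabs (M * x - M * y) < 1.
    move=> h; rewrite -Rmult_minus_distr_l Rabs_mult (Rabs_pos_eq M); last lra.
    apply: (Rmult_lt_reg_l (/ M)); first exact: Rinv_0_lt_compat.
    by rewrite -Rmult_assoc Rinv_l; lra.
  have hb : in_box (floor_pt M (p a)) 1 (floor_pt M (p b)).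
    by apply/in_boxP; split; apply/Int_part_close/sc.
  have [s' hs' hn'] := box_chain hb.
  exists (s ++ s'); first exact: chain_cat hs hs'.
  move=> x; rewrite (mem_pts_cat _ _ hs) => /orP [/hn//|/hn' h].
  exact: box_near_path h.
have := main N (leqnn N); rewrite /Rdiv Rinv_r //; lra.
Qed.

End Topology.

Lemma indefinite_choice (A B : Type) (P : A -> B -> Prop) :
  (forall a, exists b, P a b) -> exists f, forall a, P a (f a).
Proof.
move=> h; exists (fun a => proj1_sig (constructive_indefinite_description _ (h a))).
by move=> a; case: constructive_indefinite_description.
Qed.

(** * The graph as a minor of the square grid *)

Section Model.
Variables (T E : finType) (e : rel T) (src tgt : E -> T).
Hypothesis e_st : forall f, e (src f) (tgt f).
Hypothesis no_parallel : forall f g,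
  [set src f; tgt f] = [set src g; tgt g] -> f = g.

Local Open Scope R_scope.

(** The walks are roundings of the arcs scaled by [M]. Compactness gives the separations: [d1]
    between vertices, [d2] between an arc and the vertices that are not its ends, [d3] between two
    arcs away from the vertices. *)
Lemma grid_walks pos arc : plane_embedding e pos arc ->
  exists (c : T -> pt) (r : Z) (W : E -> seq ldart),
  [/\ forall v w x, in_box (c v) r x -> in_box (c w) r x -> v = w,
      forall v, in_box (c v) r (c v),
      forall f, chain (c (src f)) (W f) (c (tgt f)),
      forall f w x, x \in pts (c (src f)) (W f) -> in_box (c w) r x ->
        w = src f \/ w = tgt f &
      forall f g x, x \in pts (c (src f)) (W f) -> x \in pts (c (src g)) (W g) ->
        f <> g -> exists v, in_box (c v) r x].
Proof.
move=> [pos_inj emb].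
have weak d d' p q : d' <= d -> near d' p q -> near d p q.
  by move=> h [h1 h2]; split; lra.
have [d1 d1p sepV] : exists2 d, 0 < d &
    forall vw : T * T, near d (pos vw.1) (pos vw.2) -> vw.1 = vw.2.
  apply: finite_pos_min => [i d d' _ h P k|[v w] /=]; first exact/P/(weak _ _ _ _ h k).
  case: (eqVneq v w) => [->|ne]; first by exists 1 => //; lra.
  have cc x : cont_path (fun _ : R => x : plane).
    by move=> t; split; apply: continuity_pt_const.
  have [|s t _ _ /pos_inj h|d d0 hd] :=
      @compact_separation (fun=> pos v) (fun=> pos w) (fun=> False) (cc _) (cc _).
  - by [].
  - by rewrite h eqxx in ne.
  - by exists d => // n; case: (hd 0 0) => //; split; lra.
have [d2 d2p sepE] : exists2 d, 0 < d & forall fw : E * T, forall t, in01 t ->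
    near d (arc (src fw.1) (tgt fw.1) t) (pos fw.2) ->
    fw.2 = src fw.1 \/ fw.2 = tgt fw.1.
  apply: finite_pos_min => [i d d' _ h P t it k|[f w] /=].
    exact/(P t it)/(weak _ _ _ _ h k).
  have [ca [a0 [a1 [_ [_ [av _]]]]]] := emb _ _ (e_st f).
  have cc : cont_path (fun _ : R => pos w : plane).
    by move=> t; split; apply: continuity_pt_const.
  have [||d d0 hd] := @compact_separation (arc (src f) (tgt f)) (fun=> pos w)
      (fun=> w = src f \/ w = tgt f) ca cc.
  - by move=> s h; exists 1 => //; lra.
  - move=> s t [[s0|<-] [s1|s1]] _ h;
      [|by right; apply: pos_inj; rewrite -h s1|by left; apply: pos_inj; rewrite -h|lra].
    by case: (av s w (conj s0 s1)).
  - by exists d => // t it; apply: (hd t 0 it); split; lra.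
pose r := Rmin d1 d2 / 10.
have lr1 := Rmin_l d1 d2; have lr2 := Rmin_r d1 d2.
have r0 : 0 < r by rewrite /r; have : 0 < Rmin d1 d2 by [exact: Rmin_glb_lt]; lra.
have [d3 d3p sepEE] : exists2 d, 0 < d & forall fg : E * E, fg.1 <> fg.2 ->
    forall s t, in01 s -> in01 t ->
    near d (arc (src fg.1) (tgt fg.1) s) (arc (src fg.2) (tgt fg.2) t) ->
    exists v, near r (arc (src fg.1) (tgt fg.1) s) (pos v).
  apply: finite_pos_min => [i d d' _ h P ne s t is0 it k|[f g] /=].
    exact/(P ne s t is0 it)/(weak _ _ _ _ h k).
  case: (eqVneq f g) => [->|/eqP ne]; first by exists 1 => //; lra.
  have [ca [a0 [a1 [_ [_ [_ ax]]]]]] := emb _ _ (e_st f).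
  have [cb _] := emb _ _ (e_st g).
  have nr v : near r (pos v) (pos v).
    by split; rewrite Rminus_diag Rabs_R0.
  have [||d d0 hd] := @compact_separation (arc (src f) (tgt f)) (arc (src g) (tgt g))
      (fun s => exists v, near r (arc (src f) (tgt f) s) (pos v)) ca cb.
  - move=> s [v [n1 n2]].
    pose m := r - Rmax (Rabs (fst (arc (src f) (tgt f) s) - fst (pos v)))
                       (Rabs (snd (arc (src f) (tgt f) s) - snd (pos v))).
    have m0 : 0 < m by rewrite /m; have := Rmax_lub_lt _ _ _ n1 n2; lra.
    have [eta eta0 h] := cont_path_near s ca m0; exists eta => // s' /h [h1 h2].
    exists v; move: h1 h2; rewrite /m.
    set M1 := Rmax _ _; have := Rmax_l _ _ : _ <= M1; have := Rmax_r _ _ : _ <= M1.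
    by move=> k1 k2 h1 h2; split; move: h1 h2 k1 k2; split_Rabs; lra.
  - move=> s t [[s0|<-] [s1|s1]] it h;
      [|by exists (tgt f); rewrite s1 a1|by exists (src f); rewrite a0|lra].
    by case: (ax (src g) (tgt g) s t (e_st g) _ (conj s0 s1) it); [apply/eqP => /no_parallel|].
  - by exists d => // _ s t; apply: hd.
(* The scale makes all rounding errors small against [M * r] and [M * d3]; two walks through one
   lattice point come from arc points at scaled distance at most 4. *)
have [M [M0 Mr Md]] : exists M, [/\ 0 < M, 10 < M * r & 10 < M * d3].
  pose m := Rmin r d3; have m0 : 0 < m by apply: Rmin_glb_lt.
  have q0 : 0 < 11 / m by apply: Rdiv_lt_0_compat; lra.
  have k : 11 / m * m = 11 by field; lra.
  have l1 : m <= r := Rmin_l _ _; have l2 : m <= d3 := Rmin_r _ _.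
  exists (11 / m); split => //.
    by have := Rmult_le_compat_l _ _ _ (Rlt_le _ _ q0) l1; lra.
  by have := Rmult_le_compat_l _ _ _ (Rlt_le _ _ q0) l2; lra.
(* A box of radius [rho] contains every lattice point within 2 of a scaled point that is [r]-near
   its vertex, while two boxes that meet force their vertices to within [5 * r], half of
   [Rmin d1 d2]. *)
pose c v := floor_pt M (pos v); pose rho := up (2 * (M * r)).
have [rho1 rho2] := archimed (2 * (M * r)); rewrite -/rho in rho1 rho2.
have boxr v x : in_box (c v) rho x ->
    Rabs (IZR x.1 - M * fst (pos v)) <= 2 * (M * r) + 2 /\
    Rabs (IZR x.2 - M * snd (pos v)) <= 2 * (M * r) + 2.
  have H a y : (Z.abs (a - Int_part y) <= rho)%Z -> Rabs (IZR a - y) <= 2 * (M * r) + 2.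
    move=> h; have hy := Int_part_bounds y.
    have /IZR_le k1 : (a <= Int_part y + rho)%Z by lia.
    have /IZR_le k2 : (Int_part y - rho <= a)%Z by lia.
    by move: k1 k2; rewrite plus_IZR minus_IZR; split_Rabs; lra.
  by move=> /in_boxP [h1 h2]; split; apply: H.
have rbox v x : Rabs (IZR x.1 - M * fst (pos v)) <= M * r + 2 ->
    Rabs (IZR x.2 - M * snd (pos v)) <= M * r + 2 -> in_box (c v) rho x.
  have H a y : Rabs (IZR a - y) <= M * r + 2 -> (Z.abs (a - Int_part y) <= rho)%Z.
    move=> h; have hy := Int_part_bounds y.
    have k1 : (a <= Int_part y + rho)%Z.
      by apply: le_IZR; rewrite plus_IZR; move: h; split_Rabs; lra.
    have k2 : (Int_part y - rho <= a)%Z.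
      by apply: le_IZR; rewrite minus_IZR; move: h; split_Rabs; lra.
    by lia.
  by move=> h1 h2; apply/in_boxP; split; apply: H.
have scale d x y b : M * d > b -> Rabs (M * x - M * y) <= b -> Rabs (x - y) < d.
  move=> h1 h2; apply: (Rmult_lt_reg_l M) => //.
  by move: h2; rewrite -Rmult_minus_distr_l Rabs_mult (Rabs_pos_eq M); lra.
have rd : 10 * r = Rmin d1 d2 by rewrite /r; field.
have M10 : M * (10 * r) = 10 * (M * r) by ring.
have /indefinite_choice [W hW] : forall f, exists s,
    chain (c (src f)) s (c (tgt f)) /\
    (forall x, x \in pts (c (src f)) s -> near_path M (arc (src f) (tgt f)) x).
  move=> f.
  have [ca [a0 [a1 _]]] := emb _ _ (e_st f).
  have [s hs hn] := sampled_chain M0 ca; exists s.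
  by rewrite /c -a0 -a1.
exists c, rho, W; split.
- move=> v w x /boxr [h1 h2] /boxr [k1 k2].
  apply: (sepV (v, w)) => /=; apply: (weak _ (10 * r)); first lra.
  by split; apply: (scale _ _ _ (5 * (M * r))); try lra; move: h1 h2 k1 k2; split_Rabs; lra.
- move=> v; apply: rbox; rewrite /c /floor_pt /=.
    by have := Int_part_bounds (M * (pos v).1); split_Rabs; lra.
  by have := Int_part_bounds (M * (pos v).2); split_Rabs; lra.
- by move=> f; case: (hW f).
- move=> f w x /(hW f).2 [t it [h1 h2]] /boxr [k1 k2].
  apply: (sepE (f, w) t it) => /=; apply: (weak _ (10 * r)); first lra.
  by split; apply: (scale _ _ _ (5 * (M * r))); try lra; move: h1 h2 k1 k2; split_Rabs; lra.
- move=> f g x /(hW f).2 [s is0 [h1 h2]] /(hW g).2 [t it [k1 k2]] ne.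
  have [|v [n1 n2]] := sepEE (f, g) ne s t is0 it.
    by split => /=; apply: (scale _ _ _ 4); try lra; move: h1 h2 k1 k2; split_Rabs; lra.
  have sc a b : Rabs (a - b) < r -> Rabs (M * a - M * b) <= M * r.
    move=> h; rewrite -Rmult_minus_distr_l Rabs_mult (Rabs_pos_eq M); last lra.
    by apply: Rmult_le_compat_l; lra.
  move: n1 n2 => /= /sc n1 /sc n2.
  by exists v; apply: rbox; move: h1 h2 n1 n2; split_Rabs; lra.
Qed.

(** The branch set of [v] consists of its box and of the middle parts of the walks with source [v],
    each trimmed between the last visit to the source box and the first visit to the target box.
    Only the dart [m f] passes from one branch set to another. *)
Lemma grid_minor : planar e ->
  exists (c : T -> pt) (lab : pt -> option T)
    (A B : E -> seq ldart) (m : E -> ldart), forall f,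
  [/\ chain (c (src f)) (A f) (m f).1,
      chain (lhead (m f)) (B f) (c (tgt f)),
      {in pts (c (src f)) (A f), forall x, lab x = Some (src f)} &
      {in pts (lhead (m f)) (B f), forall x, lab x = Some (tgt f)}].
Proof.
move=> [pos [arc emb]]; have ne_st f : src f <> tgt f.
  move=> h; have [ca [a0 [a1 [_ [inj _]]]]] := emb.2 _ _ (e_st f).
  have : R0 = R1 by apply: inj; rewrite ?a0 ?a1 ?h //; split; lra.
  by lra.
have [c [r [W [disj ctr hW hV hE]]]] := grid_walks emb.
have /indefinite_choice [tr htr] : forall f, exists psm : pt * seq ldart * ldart,
    let: (p, s, m) := psm in
    [/\ chain p s m.1, in_box (c (src f)) r p, in_box (c (tgt f)) r (lhead m),
      (forall x, x \in map lhead s ->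
         ~~ in_box (c (src f)) r x && ~~ in_box (c (tgt f)) r x) &
      {subset map lhead s <= pts (c (src f)) (W f)}].
  move=> f.
  have [x xs|p [s [m h]]] := chain_trim (hW f) (ctr (src f)) (ctr (tgt f)).
    by apply/negP => xt; case: (ne_st f); apply: disj xs xt.
  by exists (p, s, m).
pose mid f := map lhead (tr f).1.2.
(* A walk meets only the boxes of its two ends, and its trimmed part avoids these. Middle parts of
   distinct edges are then disjoint, since distinct walks meet only inside boxes. *)
have nobox f x : x \in mid f -> forall v, ~~ in_box (c v) r x.
  rewrite /mid; case: (tr f) (htr f) => [[p s] m] [_ _ _ h1 h2] /= xs v.
  apply/negP => xv; have /andP [n1 n2] := h1 _ xs.
  by case: (hV f v x (h2 _ xs) xv) => ev; move: n1 n2; rewrite -ev xv.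
have midW f x : x \in mid f -> x \in pts (c (src f)) (W f).
  by rewrite /mid; case: (tr f) (htr f) => [[p s] m] [_ _ _ _ h2] /= /h2.
pose lab x := if [pick v | in_box (c v) r x] is Some v then Some v
              else omap src [pick f | x \in mid f].
have labb v x : in_box (c v) r x -> lab x = Some v.
  move=> xv; rewrite /lab; case: pickP => [w xw|/(_ v)]; last by rewrite xv.
  by rewrite (disj _ _ _ xv xw).
have labm f x : x \in mid f -> lab x = Some (src f).
  move=> xf; rewrite /lab; case: pickP => [w xw|_].
    by have := nobox _ _ xf w; rewrite xw.
  case: pickP => [g xg|/(_ f)]; last by rewrite xf.
  case: (eqVneq g f) => [->//|/eqP ne].
  have [v xv] := hE _ _ _ (midW _ _ xg) (midW _ _ xf) ne.
  by have := nobox _ _ xf v; rewrite xv.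
have /indefinite_choice [A hA] : forall f, exists s,
    chain (c (src f)) s (tr f).2.1 /\
    {in pts (c (src f)) s, forall x, lab x = Some (src f)}.
  move=> f; have := @labm f; rewrite /mid.
  case: (tr f) (htr f) => [[p s] m] [h1 hp _ _ _] /= labf.
  have [s0 h0 hb] := box_chain hp.
  exists (s0 ++ s); split; first exact: chain_cat h0 h1.
  move=> x; rewrite (mem_pts_cat _ _ h0) => /orP [/hb/labb//|].
  by rewrite inE => /orP [/eqP->|/labf//]; apply: labb.
have /indefinite_choice [B hB] : forall f, exists s,
    chain (lhead (tr f).2) s (c (tgt f)) /\
    {in pts (lhead (tr f).2) s, forall x, lab x = Some (tgt f)}.
  move=> f.
  case: (tr f) (htr f) => [[p s] m] [_ _ hm _ _] /=.
  have [s0 /chain_rev [h1 h2] hb] := box_chain hm.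
  by exists (rev_chain s0); split=> // x; rewrite h2 => /hb/labb.
exists c, lab, A, B, (fun f => (tr f).2) => f.
by have [? ?] := hA f; have [? ?] := hB f.
Qed.

End Model.

(** * Faces of a grid subgraph *)

(** The undirected edge, named by its left or lower end so that both directions receive the same
    name. *)
Definition ledge (d : ldart) : bool * pt :=
  (d.2.1, if d.2.2 then d.1 else lhead d).

Lemma ledge_rev d : ledge (lrev d) = ledge d.
Proof. by rewrite /ledge lhead_rev; case: d => p [h []]. Qed.

Lemma ledge_inj d d' : ledge d = ledge d' -> d = d' \/ d = lrev d'.
Proof.
have pos (x y : ldart) : x.2.2 -> y.2.2 -> ledge x = ledge y -> x = y.
  case: x y => p [a s] [p' [a' s']] /=.
  by rewrite /ledge /= => -> -> [-> ->].
have revs x : (lrev x).2.2 = ~~ x.2.2 by [].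
case: (boolP d.2.2) (boolP d'.2.2) => h [] h' E.
- by left; apply: pos.
- by right; apply: pos; rewrite ?revs ?ledge_rev.
- by right; apply: (can_inj lrevK); rewrite lrevK; apply: pos; rewrite ?revs ?ledge_rev.
- by left; apply: (can_inj lrevK); apply: pos; rewrite ?revs ?ledge_rev.
Qed.

Definition cw (k : dir) : dir := (~~ k.1, if k.1 then ~~ k.2 else k.2).

(* Lower left corner of the unit square to the left of a dart. *)
Definition lsq (d : ldart) : pt :=
  let: ((i, j), k) := d in
  match k with
  | (true, true) => (i, j)
  | (false, true) => (i - 1, j)%Z
  | (true, false) => (i - 1, j - 1)%Z
  | (false, false) => (i, j - 1)%Z
  end.

Lemma lsq_cw p k : lsq (p, cw k) = lsq (lrev (p, k)).
Proof. by case: p k => a b [[] []]; rewrite /lrev /lhead /=; congr pair; lia. Qed.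

(* Whether the leftward ray from the centre of the square s crosses d. *)
Definition ray (d : ldart) (s : pt) : bool :=
  [&& ~~ d.2.1, (ledge d).2.2 == s.2 & ((ledge d).2.1 <=? s.1)%Z].

Definition half_line (p s : pt) : bool := (p.2 == s.2) && (p.1 <=? s.1)%Z.

Lemma Z_eqE (a b : Z) : (a == b) = (a =? b)%Z.
Proof. by apply/eqP/idP => /Z.eqb_eq. Qed.

(** The two rays lie on one line and differ by a unit segment, which crosses only the vertical edge
    between the two squares. *)
Lemma ray_horizontal d i j :
  ray d (i, j) (+) ray d (i - 1, j)%Z = (ledge d == (false, (i, j))).
Proof.
case: d => [[a b] [[] []]]; rewrite /ray /ledge /lhead /= !xpair_eqE /= ?Z_eqE //;
  case: (Z.eqb_spec _ j) => _ //=; rewrite ?andbF ?andbT //;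
  case: Z.leb_spec => ?; case: Z.leb_spec => ?; case: Z.eqb_spec => ? //=; lia.
Qed.

(** The lattice points between the two rays form a half line. A dart leaves it either across one of
    the rays or past its right end, along the horizontal edge between the two squares. *)
Lemma ray_vertical d i j :
  ray d (i, j) (+) ray d (i, j - 1)%Z (+) (ledge d == (true, (i, j))) =
  half_line d.1 (i, j) (+) half_line (lhead d) (i, j).
Proof.
case: d => [[a b] [[] []]];
  rewrite /ray /ledge /half_line /lhead /= !xpair_eqE /= ?Z_eqE;
  repeat (case: Z.eqb_spec => /= ?); repeat (case: Z.leb_spec => /= ?) => //=; lia.
Qed.

Lemma chain_half_line p ds q s : chain p ds q ->
  \big[addb/false]_(d <- ds) (half_line d.1 s (+) half_line (lhead d) s) =
  half_line p s (+) half_line q s.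
Proof.
elim: ds p => [|d ds ih] p /=; first by move=> ->; rewrite big_nil addbb.
by move=> [<- /ih h]; rewrite big_cons h -!addbA; congr addb; rewrite addbA addbb.
Qed.

Section Rotation.
Variable H : pred ldart.

Definition rot_cw (d : ldart) : ldart :=
  let: (p, k) := d in
  if H (p, cw k) then (p, cw k) else
  if H (p, cw (cw k)) then (p, cw (cw k)) else
  if H (p, cw (cw (cw k))) then (p, cw (cw (cw k))) else (p, k).

Lemma rot_cw_tail d : (rot_cw d).1 = d.1.
Proof. by case: d => p k /=; do 3?case: ifP. Qed.

Lemma rot_cw_mem d : H d -> H (rot_cw d).
Proof. by case: d => p k /=; do 3?case: ifP. Qed.

Lemma rot_cw_inj : {in H &, injective rot_cw}.
Proof.
move=> [p k] [q l] Hd Hd' e.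
have epq : p = q by have := congr1 fst e; rewrite !rot_cw_tail.
rewrite {}epq in e Hd *; congr pair; move: Hd Hd' e; rewrite !unfold_in /=.
case: k l => [[] []] [[] []] //=; rewrite /cw /=;
by do 6?case: ifP => //=; congruence.
Qed.

(** The rotation sweeps over the squares around the tail, starting with the one on the right of [d].
    It skips only darts outside [H], across which [w] does not change; a full turn ends at [d]
    itself. *)
Lemma rot_cw_invariant (A : eqType) (w : pt -> A) :
  (forall d, ~~ H d -> w (lsq d) = w (lsq (lrev d))) ->
  forall d, w (lsq (rot_cw d)) = w (lsq (lrev d)).
Proof.
move=> hw [p k]; rewrite -lsq_cw /=.
have c4 : cw (cw (cw (cw k))) = k by case: k => [[] []].
have step l : H (p, l) = false -> w (lsq (p, l)) = w (lsq (p, cw l)).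
  by move=> n; rewrite lsq_cw hw // n.
case: ifP => // /step ->; case: ifP => // /step ->.
by case: ifP => // /step ->; rewrite c4.
Qed.

End Rotation.

(** If two first returns coincide, cancelling the shorter run puts one starting point on the run of
    the other, strictly before its first return unless the two are equal. *)
Lemma first_return (D G : finType) (phi : D -> D) (mk : G -> D) :
  injective phi -> injective mk ->
  exists psi : {perm G}, forall g, exists k,
    mk (psi g) = iter k.+1 phi (mk g) /\
    forall j, j < k -> iter j.+1 phi (mk g) \notin codom mk.
Proof.
move=> phi_inj mk_inj.
have ex g : exists n, iter n.+1 phi (mk g) \in codom mk.
  exists (fingraph.order phi (mk g)).-1; rewrite prednK ?fingraph.order_gt0 // iter_order //.
  exact: codom_f.
pose k g := ex_minn (ex g).
have kP g : iter (k g).+1 phi (mk g) \in codom mk by rewrite /k; case: ex_minnP.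
have kmin g j : iter j.+1 phi (mk g) \in codom mk -> k g <= j.
  by rewrite /k; case: ex_minnP => n _ + h; apply.
have iter_inj n : injective (iter n phi).
  by elim: n => [|n ih] x y //= /phi_inj /ih.
pose psi g := iinv (kP g).
have psiE g : mk (psi g) = iter (k g).+1 phi (mk g) by rewrite /psi f_iinv.
have psi_inj : injective psi.
  suff le g g' : k g <= k g' -> psi g = psi g' -> g = g'.
    by move=> g g' E; case/orP: (leq_total (k g) (k g')) => /le h; [|apply/esym]; apply: h.
  move=> kl E; have := congr1 mk E; rewrite !psiE.
  rewrite -(subnKC kl) -addSn iterD => /iter_inj h.
  apply: mk_inj; rewrite h; case En: (k g' - k g) => [//|n].
  have : k g' <= n by apply: kmin; rewrite -En -h; apply: codom_f.
  by move/(leq_trans (leq_subr (k g) (k g'))); rewrite En ltnn.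
exists (perm psi_inj) => g; exists (k g); rewrite permE; split => // j jk.
by apply/negP => /kmin; rewrite leqNgt jk.
Qed.

(** * From the grid minor to a face permutation *)

Section PlanarMap.
Variables (T E : finType) (src tgt : E -> T).

Definition drev (d : E * bool) : E * bool := (d.1, ~~ d.2).
Definition dtail (d : E * bool) : T := if d.2 then src d.1 else tgt d.1.

(** The cycle space over $\mathbb F_2$: edge sets with even degree at every vertex. *)
Definition even_chain (z : E -> bool) : Prop := forall v,
  \big[addb/false]_f (z f && ((src f == v) (+) (tgt f == v))) = false.

(* phi is the face permutation of the darts.  Every even edge set z bounds a
   set w of faces: the edges of z are those having w on exactly one side. *)
Definition planar_map : Prop := exists phi : {perm E * bool},
  (forall d, dtail (phi d) = dtail (drev d)) /\
  forall z, even_chain z -> exists w : E * bool -> bool,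
    forall d, w (phi d) = w d /\ w d (+) w (drev d) = z d.1.

Hypothesis ne_st : forall f, src f <> tgt f.
Hypothesis no_parallel : forall f g,
  [set src f; tgt f] = [set src g; tgt g] -> f = g.

Variables (c : T -> pt) (lab : pt -> option T) (A B : E -> seq ldart) (m : E -> ldart).
Hypothesis chainA : forall f, chain (c (src f)) (A f) (m f).1.
Hypothesis chainB : forall f, chain (lhead (m f)) (B f) (c (tgt f)).
Hypothesis labA : forall f, {in pts (c (src f)) (A f), forall x, lab x = Some (src f)}.
Hypothesis labB : forall f, {in pts (lhead (m f)) (B f), forall x, lab x = Some (tgt f)}.

Let walk f := A f ++ m f :: B f.
Let HD : seq ldart := flatten [seq walk f ++ map lrev (walk f) | f <- enum E].
Let mark (d : E * bool) : ldart := if d.2 then m d.1 else lrev (m d.1).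

Lemma HD_P d : reflect (exists f, d \in walk f \/ lrev d \in walk f) (d \in HD).
Proof.
apply: (iffP flatten_mapP) => [[f _]|[f h]].
  rewrite mem_cat => /orP [h|/mapP [d' h ->]]; exists f; [by left|right].
  by rewrite lrevK.
exists f; first by rewrite mem_enum.
by rewrite mem_cat; case: h => [->//|h]; rewrite -[d]lrevK map_f ?orbT.
Qed.

Lemma HD_rev d : (lrev d \in HD) = (d \in HD).
Proof.
by apply/HD_P/HD_P => -[f h]; exists f; move: h; rewrite lrevK; case; auto.
Qed.

Lemma mark_HD d : mark d \in HD.
Proof.
have h f : m f \in HD.
  by apply/HD_P; exists f; left; rewrite /walk mem_cat inE eqxx orbT.
by rewrite /mark; case: ifP => _; rewrite ?HD_rev.
Qed.

Lemma mark_rev d : mark (drev d) = lrev (mark d).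
Proof. by rewrite /mark; case: d => f [] /=; rewrite ?lrevK. Qed.

Lemma lab_mark d : lab (mark d).1 = Some (dtail d).
Proof.
case: d => f []; rewrite /mark /dtail /=.
  by apply: labA; apply: chain_last.
by apply: labB; rewrite inE eqxx.
Qed.

Lemma lab_side f d : d \in A f \/ d \in B f -> lab d.1 = lab (lhead d).
Proof.
by case=> h; [rewrite !(@labA f)|rewrite !(@labB f)]; rewrite ?inE ?map_f ?orbT //;
  apply: chain_tail h.
Qed.

(** Every dart of a walk other than its mark stays inside one branch set, so contracting the branch
    sets leaves just the marked darts. *)
Lemma lab_unmarked d : d \in HD -> d \notin codom mark -> lab d.1 = lab (lhead d).
Proof.
have h f d' : d' \in walk f -> d' = m f \/ lab d'.1 = lab (lhead d').
  rewrite mem_cat inE => /or3P [h|/eqP->|h]; [right|by left|right];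
    by apply: (@lab_side f); auto.
move=> /HD_P [f [/h|/h]] {h} [h|h] n //.
- by case/negP: n; rewrite h (codom_f mark (f, true)).
- by case/negP: n; rewrite -[d]lrevK h (codom_f mark (f, false)).
- by move: h; rewrite lhead_rev => <-.
Qed.

Lemma mark_ledge f d : ledge d = ledge (m f) -> lab d.1 <> lab (lhead d).
Proof.
have l1 := lab_mark (f, true); have l2 := lab_mark (f, false).
rewrite /mark /dtail /= in l1 l2.
by case/ledge_inj => ->; rewrite ?lhead_rev /= l1 l2 => -[h]; case: (@ne_st f).
Qed.

Lemma mark_ledge_inj f g : ledge (m f) = ledge (m g) -> f = g.
Proof.
have l1 h := lab_mark (h, true); have l2 h := lab_mark (h, false).
rewrite /mark /dtail /= in l1 l2.
have [h1 h2] := (l1 f, l2 f).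
case/ledge_inj => eq; apply: no_parallel; move: h1 h2; rewrite eq ?lhead_rev /=.
  by rewrite l1 l2 => -[->] [->].
by rewrite l1 l2 => -[->] [->]; rewrite setUC.
Qed.

Lemma mark_inj : injective mark.
Proof.
have le d : ledge (mark d) = ledge (m d.1).
  by rewrite /mark; case: ifP; rewrite ?ledge_rev.
move=> d d' eq; have := congr1 ledge eq; rewrite !le => /mark_ledge_inj.
have := congr1 (lab \o fst) eq; rewrite /= !lab_mark.
case: d d' {eq} => f b [g b'] /= l fg; move: l; rewrite fg /dtail /= => -[].
by case: b b' => [] [] // h; case: (@ne_st g); rewrite h.
Qed.

Lemma walk_chain f : chain (c (src f)) (walk f) (c (tgt f)).
Proof. exact: chain_cat (chainA f) _. Qed.

(** A marked edge joins different labels, whereas the remaining darts of every walk keep their label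
    and so never run along it. *)
Lemma walk_mark f g :
  \big[addb/false]_(d <- walk g) (ledge d == ledge (m f)) = (g == f).
Proof.
have off s : (forall d, d \in s -> lab d.1 = lab (lhead d)) ->
    \big[addb/false]_(d <- s) (ledge d == ledge (m f)) = false.
  move=> h; rewrite big_seq big1 // => d /h hd.
  by apply/eqP => /mark_ledge.
rewrite big_cat big_cons /= !off ?addbF //=; try by move=> d h; apply: (@lab_side g); auto.
by apply/eqP/eqP => [/mark_ledge_inj|->].
Qed.

Section Chain.
Variable z : E -> bool.
Hypothesis z_even : even_chain z.

(** The winding number modulo 2 of [z], drawn in the grid, around the centre of the square [s]. *)
Let wind (s : pt) := \big[addb/false]_f (z f && \big[addb/false]_(d <- walk f) ray d s).
Let cross (x : bool * pt) :=
  \big[addb/false]_f (z f && \big[addb/false]_(d <- walk f) (ledge d == x)).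

Lemma wind_cross d : wind (lsq d) (+) wind (lsq (lrev d)) = cross (ledge d).
Proof.
have hor i j : wind (i, j) (+) wind (i - 1, j)%Z = cross (false, (i, j)).
  rewrite /wind /cross -big_split; apply: eq_bigr => f _ /=.
  rewrite -andb_addr -big_split; congr andb; apply: eq_bigr => x _ /=.
  exact: ray_horizontal.
(* Exchanging the sums collects, for each vertex drawn on the half line, its degree in [z], which is
   even. *)
have bnd s : \big[addb/false]_f (z f && (half_line (c (src f)) s (+)
    half_line (c (tgt f)) s)) = false.
  transitivity (\big[addb/false]_f \big[addb/false]_v
      (half_line (c v) s && (z f && ((src f == v) (+) (tgt f == v))))).
    apply: eq_bigr => f _; rewrite andbC.
    have pick1 u : \big[addb/false]_v (half_line (c v) s && (u == v)) = half_line (c u) s.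
      rewrite (bigD1 u) //= eqxx andbT big1 ?addbF // => v /negbTE.
      by rewrite eq_sym => ->; rewrite andbF.
    rewrite -(pick1 (src f)) -(pick1 (tgt f)) -big_split /= big_distrl /=.
    by apply: eq_bigr => v _; rewrite -andb_addr -andbA [z f && _]andbC.
  rewrite exchange_big big1 // => v _.
  by rewrite -big_distrr /= z_even andbF.
have ver i j : wind (i, j) (+) wind (i, j - 1)%Z = cross (true, (i, j)).
  apply/eqP; rewrite -[_ == _]negbK negb_eqb; apply/negbT.
  rewrite -(bnd (i, j)) /wind /cross -!big_split; apply: eq_bigr => f _ /=.
  rewrite -!andb_addr -(chain_half_line _ (walk_chain f)) -!big_split /=; congr andb.
  by apply: eq_bigr => x _; apply: ray_vertical.
have pos (x : ldart) : x.2.2 -> wind (lsq x) (+) wind (lsq (lrev x)) = cross (ledge x).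
  case: x => [[i j] [[] []]] // _; rewrite /ledge /lrev /lhead /=.
    by rewrite -ver; congr (_ (+) wind _); congr pair; lia.
  by rewrite -hor addbC; congr (wind _ (+) _); congr pair; lia.
case: (boolP d.2.2) => [/pos//|n].
by rewrite -ledge_rev -pos // lrevK addbC.
Qed.

Lemma cross_notin d : d \notin HD -> cross (ledge d) = false.
Proof.
move=> n; rewrite /cross big1 // => f _; rewrite big_seq big1 ?andbF // => x xf.
apply/eqP => /esym /ledge_inj h; case/negP: n; apply/HD_P; exists f.
by case: h => ->; [left|right; rewrite lrevK].
Qed.

Lemma cross_mark f : cross (ledge (m f)) = z f.
Proof.
rewrite /cross (bigD1 f) //= walk_mark eqxx andbT big1 ?addbF // => g /negbTE h.
by rewrite walk_mark h andbF.
Qed.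

Lemma wind_face d :
  wind (lsq (rot_cw (mem HD) (lrev d))) = wind (lsq d).
Proof.
rewrite rot_cw_invariant ?lrevK // => x n.
by apply/eqP; rewrite -[_ == _]negbK negb_eqb wind_cross cross_notin.
Qed.

Lemma wind_mark f : wind (lsq (m f)) (+) wind (lsq (lrev (m f))) = z f.
Proof. by rewrite wind_cross cross_mark. Qed.

End Chain.

(** Reversing a dart and rotating clockwise is turning left; the first return of this grid face
    permutation to the marked darts is the face permutation of the graph. The set bounded by [z] is
    the winding parity on the left of the marks. *)
Lemma grid_planar_map : planar_map.
Proof.
pose face (d : seq_sub HD) : ldart := rot_cw (mem HD) (lrev (val d)).
have faceH d : face d \in HD.
  by apply: (@rot_cw_mem (mem HD)); rewrite /= HD_rev; apply: valP.
pose phi d : seq_sub HD := SeqSub (faceH d).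
have phi_inj : injective phi.
  move=> x y /(congr1 val) /= h; apply/val_inj/(can_inj lrevK).
  by apply: rot_cw_inj h; rewrite unfold_in /= HD_rev; apply: valP.
pose mk d : seq_sub HD := SeqSub (mark_HD d).
have mk_inj : injective mk by move=> x y /(congr1 val) /= /mark_inj.
have [psi hpsi] := first_return phi_inj mk_inj.
have phi_tail x : (val (phi x)).1 = lhead (val x) by rewrite /= rot_cw_tail.
exists psi; split.
  move=> d; have [k [h1 h2]] := hpsi d.
  (* Up to the next mark the face walk stays in the branch set that [mark d] enters. *)
  have key j : j <= k -> lab (val (iter j.+1 phi (mk d))).1 = lab (lhead (mark d)).
    elim: j => [_|j ih jk]; first by rewrite /= -/(phi _) phi_tail.
    rewrite iterS phi_tail -(ih (ltnW jk)); apply/esym/lab_unmarked.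
      exact: valP.
    have := h2 j jk; apply: contra => /codomP [g eg].
    by apply/codomP; exists g; apply: val_inj.
  have := key k (leqnn k); rewrite -h1 /= lab_mark.
  have := lab_mark (drev d); rewrite mark_rev /= => -> [->//].
move=> z z_even.
exists (fun d => \big[addb/false]_f (z f &&
  \big[addb/false]_(x <- walk f) ray x (lsq (mark d)))) => d; split.
  have [k [h1 _]] := hpsi d; have {h1} := congr1 val h1; rewrite [val (mk _)]/= => ->.
  elim: k.+1 => [//|j ih]; rewrite -[RHS]ih iterS [val (phi _)]/= /face.
  exact: (wind_face z_even).
rewrite mark_rev; case: d => f []; first exact: (wind_mark z_even).
rewrite (_ : mark (f, false) = lrev (m f)) // lrevK addbC.
exact: (wind_mark z_even).
Qed.

End PlanarMap.

Lemma planar_map_of_planar (T E : finType) (e : rel T) (src tgt : E -> T) :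
  irreflexive e -> (forall f, e (src f) (tgt f)) ->
  (forall f g, [set src f; tgt f] = [set src g; tgt g] -> f = g) ->
  planar e -> planar_map src tgt.
Proof.
move=> irr est npar /(grid_minor est npar) [c [lab [A [B [m h]]]]].
have ne f : src f <> tgt f by move=> h1; have := est f; rewrite h1 irr.
by apply: (@grid_planar_map _ _ _ _ ne npar c lab A B m) => f; case: (h f).
Qed.

(** * Counting faces over the two-element field *)

Lemma porbit_invariant (D : finType) (A : Type) (phi : {perm D}) (w : D -> A) d d' :
  (forall x, w (phi x) = w x) -> d' \in porbit phi d -> w d' = w d.
Proof.
move=> wP /porbitP [k ->].
by elim: k => [|k ih]; rewrite ?expg0 ?perm1 // expgSr permM wP.
Qed.

Section Rank.
Variables (T E : finType) (src tgt : E -> T).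
Local Open Scope ring_scope.

Lemma sum_indicator (I : finType) (A : {set I}) (i : I) : i \in A ->
  \sum_(j < #|A|) (i == enum_val j :> I) = true :> bool.
Proof.
move=> iA; rewrite (bigD1 (enum_rank_in iA i)) //= enum_rankK_in // eqxx.
rewrite big1 ?addr0 // => j ne; apply: negbTE; apply/eqP => h.
by case/eqP: ne; apply: enum_val_inj; rewrite -h enum_rankK_in.
Qed.

Section Vertices.
Variable S : {set T}.
Hypothesis srcS : forall f, src f \in S.
Hypothesis tgtS : forall f, tgt f \in S.

(** Here [bool] is the field $\mathbb F_2$, and the left kernel is the cycle space. *)
Definition boundary_mx : 'M[bool]_(#|E|, #|S|) :=
  \matrix_(i, j) ((src (enum_val i) == enum_val j) + (tgt (enum_val i) == enum_val j)).

Definition row_chain (z : 'rV[bool]_#|E|) (f : E) : bool := z 0 (enum_rank f).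

Lemma even_row_chain z : z *m boundary_mx = 0 -> even_chain src tgt (row_chain z).
Proof.
move=> hz v; case: (boolP (v \in S)) => vS; last first.
  rewrite big1 // => f _.
  rewrite (_ : src f == v = false); last by apply/eqP => h; rewrite -h srcS in vS.
  rewrite (_ : tgt f == v = false); last by apply/eqP => h; rewrite -h tgtS in vS.
  by rewrite andbF.
have := congr1 (fun u : 'rV[bool]_#|S| => u 0 (enum_rank_in vS v)) hz.
rewrite !mxE => h; rewrite -[RHS]h (reindex enum_rank) /=; last first.
  by exists enum_val => x _; rewrite ?enum_rankK ?enum_valK.
apply: eq_bigr => f _; rewrite !mxE enum_rankK enum_rankK_in //.
Qed.

(** Each edge has two ends, so the all-ones column is annihilated. *)
Lemma boundary_rank : (0 < #|S|)%N -> (\rank boundary_mx < #|S|)%N.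
Proof.
move=> S0; pose o : 'M[bool]_(#|S|, 1) := const_mx true.
have b0 : boundary_mx *m o = 0.
  apply/matrixP => i j; rewrite !mxE.
  under eq_bigr => k _ do rewrite !mxE mulr1.
  by rewrite big_split /= !sum_indicator.
have o0 : o != 0.
  by apply/eqP => /matrixP /(_ (Ordinal S0) 0); rewrite !mxE.
apply: leq_trans (mulmx0_rank_max b0).
by rewrite -addn1 leq_add2l lt0n mxrank_eq0.
Qed.

(* A functional vanishing on the kernel of the boundary map factors through it,
   and the functionals of that form are the cuts. *)
Lemma cut_of_orthogonal (X : {set E}) :
  (forall z, even_chain src tgt z -> \big[addb/false]_(f in X) z f = false) ->
  exists A : {set T}, forall f, (f \in X) = (src f \in A) (+) (tgt f \in A).
Proof.
move=> hX; pose x : 'cV[bool]_#|E| := \col_i (enum_val i \in X).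
have orth (z : 'rV[bool]_#|E|) : z *m boundary_mx = 0 -> z *m x = 0.
  move=> /even_row_chain /hX h; apply/matrixP => i j; rewrite !ord1 [RHS]mxE -[RHS]h.
  rewrite mxE [RHS]big_mkcond (reindex enum_rank) /=; last first.
    by exists enum_val => y _; rewrite ?enum_rankK ?enum_valK.
  apply: eq_bigr => f _; rewrite !mxE enum_rankK.
  by case: ifP => _; [exact: mulr1|exact: mulr0].
have : (x^T <= boundary_mx^T)%MS.
  rewrite submxE -[_ *m _]trmxK trmx_mul trmxK.
  rewrite (_ : _ *m x = 0) ?trmx0 //; apply/row_matrixP => i.
  rewrite row_mul row0; apply: orth; rewrite -row_mul.
  by rewrite -[X in _ *m X]trmxK -trmx_mul mulmx_coker trmx0 row0.
(* [a] writes [X] as a sum of vertex stars; the vertices with coefficient 1 form one side of the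
   cut. *)
case/submxP => a ha.
exists [set v | [exists j : 'I_#|S|, (enum_val j == v) && a 0 j]] => f.
have := congr1 (fun u : 'rV[bool]_#|E| => u 0 (enum_rank f)) ha.
rewrite !mxE enum_rankK => ->.
have pick1 v : v \in S -> \sum_(j < #|S|) (a 0 j * (v == enum_val j)) =
    [exists j : 'I_#|S|, (enum_val j == v) && a 0 j] :> bool.
  move=> vS; rewrite (bigD1 (enum_rank_in vS v)) //= enum_rankK_in // eqxx.
  rewrite big1 => [|j ne]; last first.
    rewrite (_ : v == _ = false) ?mulr0 //; apply/eqP => h.
    by case/eqP: ne; apply: enum_val_inj; rewrite -h enum_rankK_in.
  rewrite mulr1 addr0; apply/idP/existsP => [h|[j /andP [/eqP h]]].
    by exists (enum_rank_in vS v); rewrite enum_rankK_in // eqxx.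
  by rewrite (_ : enum_rank_in vS v = j) //; apply: enum_val_inj; rewrite enum_rankK_in.
rewrite !inE -!pick1 // -[RHS]big_split /=; apply: eq_bigr => j _.
by rewrite !mxE enum_rankK mulrDr.
Qed.

(** The rows of [P] are the face boundaries. They span the cycle space by hypothesis, and they sum
    to zero because each edge has two darts. Comparing ranks gives [#|E| - (#|S| - 1) <= N - 1]. *)
Lemma faces_bound (phi : {perm E * bool}) :
  (0 < #|S|)%N -> (0 < #|E|)%N ->
  (forall z, even_chain src tgt z -> exists w : E * bool -> bool,
    forall d, w (phi d) = w d /\ w d (+) w (drev d) = z d.1) ->
  (#|E| + 2 <= #|S| + #|porbits phi|)%N.
Proof.
move=> S0 E0 hw; set N := #|porbits phi|.
pose P : 'M[bool]_(N, #|E|) :=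
  \matrix_(i, j) ((porbit phi (enum_val j, true) == enum_val i) +
                  (porbit phi (enum_val j, false) == enum_val i)).
have orb d : porbit phi d \in porbits phi by apply: imset_f.
have kP : (kermx boundary_mx <= P)%MS.
  apply/row_subP => i; set z := row i _.
  have /even_row_chain /hw [w wP] : z *m boundary_mx = 0.
    by rewrite -row_mul mulmx_ker row0.
  have wO d d' : d' \in porbit phi d -> w d' = w d.
    by apply: porbit_invariant => x; case: (wP x).
  pose u : 'rV[bool]_N := \row_j [exists d in enum_val j : {set _}, w d].
  apply/submxP; exists u; apply/matrixP => r j; rewrite !ord1 [RHS]mxE.
  have wE d : \sum_(k < N) (u 0 k * (porbit phi d == enum_val k)) = w d :> bool.
    rewrite (bigD1 (enum_rank_in (orb d) (porbit phi d))) //= enum_rankK_in // eqxx.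
    rewrite big1 => [|k ne]; last first.
      rewrite (_ : porbit phi d == _ = false) ?mulr0 //; apply/eqP => h.
      by case/eqP: ne; apply: enum_val_inj; rewrite -h enum_rankK_in.
    rewrite mulr1 addr0 mxE enum_rankK_in //.
    apply/existsP/idP => [[d' /andP [/wO -> //]]|h].
    by exists d; rewrite porbit_id.
  under [RHS]eq_bigr => k _ do rewrite [P _ _]mxE mulrDr.
  rewrite big_split /= !wE; have := (wP (enum_val j, true)).2.
  by rewrite /row_chain enum_valK.
have P1 : (const_mx true : 'rV[bool]_N) *m P = 0.
  apply/matrixP => i j; rewrite !mxE.
  under eq_bigr => k _ do rewrite !mxE mul1r.
  by rewrite big_split /= !sum_indicator.
have N0 : (0 < N)%N.
  by have [f _] := card_gt0P E0; apply/card_gt0P; exists (porbit phi (f, true)).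
have o0 : (const_mx true : 'rV[bool]_N) != 0.
  by apply/eqP => /matrixP /(_ 0 (Ordinal N0)); rewrite !mxE.
have := mulmx0_rank_max P1; rewrite rank_rV o0.
have := mxrankS kP; rewrite mxrank_ker.
have := boundary_rank S0; have := rank_leq_row boundary_mx.
by lia.
Qed.

End Vertices.
End Rank.

(** * Discharging *)

Lemma eq_set2 (T : finType) (a b c d : T) :
  [set a; b] = [set c; d] -> (a = c /\ b = d) \/ (a = d /\ b = c).
Proof.
move=> h; have ha : a \in [set c; d] by rewrite -h set21.
have hb : b \in [set c; d] by rewrite -h set22.
have hc : c \in [set a; b] by rewrite h set21.
have hd : d \in [set a; b] by rewrite h set22.
move: ha hb hc hd; rewrite !inE.
by do 4!(case/orP=> /eqP ?); subst; auto.
Qed.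

Lemma sum_porbits (D : finType) (phi : {perm D}) (F : D -> nat) :
  \sum_(O in porbits phi) \sum_(d in O) F d = \sum_d F d.
Proof.
rewrite [RHS](partition_big (porbit phi) (mem (porbits phi))) /=; last first.
  by move=> d _; apply: imset_f.
apply: eq_bigr => O /imsetP [x _ ->]; apply: eq_bigl => d.
by rewrite eq_porbit_mem porbit_sym.
Qed.

Lemma mem_porbit_step (D : finType) (phi : {perm D}) (x : D) : phi x \in porbit phi x.
Proof. by have := mem_porbit phi 1 x; rewrite expg1. Qed.

Lemma porbit_step (D : finType) (phi : {perm D}) (x : D) : porbit phi (phi x) = porbit phi x.
Proof. by apply/eqP; rewrite eq_porbit_mem mem_porbit_step. Qed.

Lemma sum_porbit_shift (D : finType) (phi : {perm D}) (x : D) (F : D -> nat) :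
  \sum_(d in porbit phi x) F (phi d) = \sum_(d in porbit phi x) F d.
Proof.
rewrite [RHS](reindex_inj (@perm_inj _ phi)); apply: eq_bigl => d.
by rewrite -!eq_porbit_mem porbit_step.
Qed.

Section Discharging.
Variables (T E : finType) (e : rel T) (src tgt : E -> T).
Hypothesis e_sym : symmetric e.
Hypothesis e_irr : irreflexive e.
Hypothesis e_st : forall f, e (src f) (tgt f).
Hypothesis no_parallel : forall f g,
  [set src f; tgt f] = [set src g; tgt g] -> f = g.
Hypothesis no_intersecting_triangles : forall C D : {set {set T}},
  is_triangle e C -> is_triangle e D -> C != D -> ~ intersecting_cycles C D.
Hypothesis triangle_adj_at_most_one_4cycle : forall C Q1 Q2 : {set {set T}},
  is_triangle e C -> is_4cycle e Q1 -> is_4cycle e Q2 ->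
  adjacent_cycles C Q1 -> adjacent_cycles C Q2 -> Q1 = Q2.

Variable phi : {perm E * bool}.
Local Notation tail := (dtail src tgt).
Hypothesis phi_tail : forall d, tail (phi d) = tail (drev d).
Hypothesis phi_w : forall z, even_chain src tgt z ->
  exists w : E * bool -> bool,
    forall d, w (phi d) = w d /\ w d (+) w (drev d) = z d.1.
(** By orthogonality of cycles and cuts, [sep1] and [sep2] say that neither one edge nor two edges
    form a cut. *)
Hypothesis sep1 : forall f, exists2 z, even_chain src tgt z & z f.
Hypothesis sep2 : forall f g, f <> g ->
  exists2 z, even_chain src tgt z & z f <> z g.

Let fsize (d : E * bool) : nat := #|porbit phi d|.

Lemma drevK : involutive (@drev E).
Proof. by case=> f b; rewrite /drev /= negbK. Qed.

Lemma dart_adj d : e (tail d) (tail (drev d)).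
Proof. by case: d => f []; rewrite /dtail /= // e_sym. Qed.

Lemma dart_inj d d' : tail d = tail d' -> tail (drev d) = tail (drev d') -> d = d'.
Proof.
case: d d' => f b [g b'] h1 h2.
have fg : f = g.
  apply: no_parallel; move: h1 h2; rewrite /dtail /=.
  by case: b b' => [] [] /= -> ->; rewrite // setUC.
subst g; case: (eqVneq b b') => [->//|ne].
have eb : drev (f, b) = (f, b') by rewrite /drev /=; case: b b' ne {h1 h2} => [] [].
by have := dart_adj (f, b); rewrite h1 eb e_irr.
Qed.

(** A face on both sides of an edge would give them the same [w], although some even set contains
    the edge. *)
Lemma rev_notin_face d : drev d \notin porbit phi d.
Proof.
apply/negP => h; have [z /phi_w [w wP] zd] := sep1 d.1.
have := (wP d).2; rewrite (porbit_invariant _ h) ?addbb ?zd //.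
by move=> x; case: (wP x).
Qed.

Lemma phi_rev_neq d : phi d <> drev d.
Proof. by move=> h; have := rev_notin_face d; rewrite -h mem_porbit_step. Qed.

Lemma same_edge (d d' : E * bool) : d.1 = d'.1 -> d' = d \/ d' = drev d.
Proof. by case: d d' => f [] [g []] /= ->; [left|right|right|left]. Qed.

(* At the head of d, the edges of d and phi d would form a two-edge cut. *)
Lemma no_digon_corner d : phi (drev (phi d)) <> drev d.
Proof.
move=> h; have /sep2 [z /phi_w [w wP] zne] : d.1 <> (phi d).1.
  case/same_edge => [k|]; last exact: phi_rev_neq.
  by have := dart_adj d; rewrite -phi_tail k e_irr.
(* The same two faces lie along both edges, so every even set contains both or neither. *)
apply: zne; rewrite -(wP d).2 -(wP (phi d)).2 (wP d).1; congr addb.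
by rewrite -h (wP _).1.
Qed.

(** Both [d'] and [drev (phi d)] end at the head of [d]; with equal tails they coincide, as there
    are no parallel edges, and the corner becomes a two-edge cut. *)
Lemma no_closing_corner d d' :
  phi d' = drev d -> tail d' = tail (drev (phi d)) -> False.
Proof.
move=> h1 h2; apply: (@no_digon_corner d).
rewrite (_ : drev (phi d) = d') //; apply: dart_inj => //.
by rewrite drevK -phi_tail h1 -phi_tail.
Qed.

Lemma iter_fsize d : iter (fsize d) phi d = d.
Proof. exact: iter_porbit. Qed.

Lemma fsize_phi d : fsize (phi d) = fsize d.
Proof. by rewrite /fsize porbit_step. Qed.

(** Length 1 would be a loop; length 2 would force [phi d] to be the reversal of [d]. *)
Lemma fsize_ge3 d : 2 < fsize d.
Proof.
have := iter_fsize d; have : 0 < fsize d by apply/card_gt0P; exists d; rewrite porbit_id.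
case: (fsize d) => [|[|[|n]]] //= _ h.
  by have := dart_adj d; rewrite -phi_tail h e_irr.
case: (@phi_rev_neq d); apply: dart_inj; first exact: phi_tail.
by rewrite drevK -phi_tail h.
Qed.

Definition tri (d : E * bool) : {set {set T}} :=
  let x := tail d in let y := tail (phi d) in let z := tail (phi (phi d)) in
  [set [set x; y]; [set y; z]; [set z; x]].

Definition quad (d : E * bool) : {set {set T}} :=
  let x := tail d in let y := tail (phi d) in
  let z := tail (phi (phi d)) in let u := tail (phi (phi (phi d))) in
  [set [set x; y]; [set y; z]; [set z; u]; [set u; x]].

Lemma adj_phi d : e (tail d) (tail (phi d)).
Proof. by rewrite phi_tail dart_adj. Qed.

Lemma adj_neq x y : e x y -> x <> y.
Proof. by move=> h xy; rewrite xy e_irr in h. Qed.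

Lemma tri_face d : fsize d = 3 -> is_triangle e (tri d).
Proof.
move=> n3; have h := iter_fsize d; rewrite n3 /= in h.
exists (tail d), (tail (phi d)), (tail (phi (phi d))); split => //.
have e1 := adj_phi d; have e2 := adj_phi (phi d); have e3 := adj_phi (phi (phi d)).
rewrite h in e3; rewrite e1 e2 e3 !andbT /= !inE negb_or andbT -!andbA.
by apply/and3P; split; apply/eqP => // k;
  [rewrite k e_irr in e1|rewrite -k e_irr in e3|rewrite k e_irr in e2].
Qed.

Lemma phi2_tail_neq d : tail (phi (phi d)) <> tail d.
Proof.
move=> h; case: (@phi_rev_neq d); apply: dart_inj; first exact: phi_tail.
by rewrite drevK -phi_tail.
Qed.

Lemma quad_face d : fsize d = 4 -> is_4cycle e (quad d).
Proof.
move=> n4; have h := iter_fsize d; rewrite n4 /= in h.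
exists (tail d), (tail (phi d)), (tail (phi (phi d))), (tail (phi (phi (phi d)))).
split => //.
have e1 := adj_phi d; have e2 := adj_phi (phi d); have e3 := adj_phi (phi (phi d)).
have e4 := adj_phi (phi (phi (phi d))); rewrite h in e4.
rewrite e1 e2 e3 e4 !andbT /= !inE !negb_or andbT -!andbA.
have n1 := @phi2_tail_neq d; have n2 := @phi2_tail_neq (phi d).
apply/and5P; split; try apply/andP; try split; apply/eqP => k //;
  by [rewrite k e_irr in e1|rewrite -k e_irr in e4|rewrite k e_irr in e2|rewrite k e_irr in e3|
      case: n1|case: n2].
Qed.

Lemma tri_eq d d' v : fsize d = 3 -> fsize d' = 3 ->
  v \in [set tail d; tail (phi d)] -> v \in [set tail d'; tail (phi d')] ->
  tri d = tri d'.
Proof.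
move=> n3 n3' h h'; apply/eqP/negP => /negP ne.
apply: (no_intersecting_triangles (tri_face n3) (tri_face n3') ne).
by apply/set0Pn; exists v; rewrite inE; apply/andP; split; apply/bigcupP;
  [exists [set tail d; tail (phi d)]|exists [set tail d'; tail (phi d')]] => //;
  rewrite !inE eqxx.
Qed.

(* The two edges at the head of d would lie on the same triangle. *)
Lemma no_tri_tri d : fsize (drev d) = 3 -> fsize (drev (phi d)) = 3 -> False.
Proof.
move=> n3 n3'; have h := iter_fsize (drev d); rewrite n3 /= in h.
have v1 : tail (phi d) \in [set tail (drev d); tail (phi (drev d))].
  by rewrite phi_tail set21.
have v2 : tail (phi d) \in [set tail (drev (phi d)); tail (phi (drev (phi d)))].
  by rewrite (phi_tail (drev (phi d))) drevK set22.
have E1 := tri_eq n3 n3' v1 v2.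
have xE : tail (phi (drev d)) = tail d by rewrite phi_tail drevK.
have : [set tail (drev (phi d)); tail (drev d)] \in tri (drev d).
  by rewrite E1 /tri (phi_tail (drev (phi d))) drevK phi_tail !inE eqxx.
have xy := adj_neq (dart_adj d); have ya := @phi2_tail_neq (drev d).
have := @phi2_tail_neq d; rewrite phi_tail => xz.
rewrite /tri xE !inE => /orP [/orP []|] /eqP /eq_set2 [] [k1 k2] //.
- by case: xy; rewrite k2.
- by case: xy; rewrite k2.
- exact: (no_closing_corner h (esym k1)).
- by case: ya; rewrite -k2.
Qed.

(** The two faces share a vertex, hence bound the same triangle. The edge of [phi d] is then the
    side of the other face that closes up at the head of [d]. *)
Lemma no_tri_rev_tri d : fsize d = 3 -> fsize (drev d) = 3 -> False.
Proof.
move=> n3 n3'; have h := iter_fsize (drev d); rewrite n3' /= in h.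
have xE : tail (phi (drev d)) = tail d by rewrite phi_tail drevK.
have v1 : tail d \in [set tail d; tail (phi d)] by rewrite set21.
have v2 : tail d \in [set tail (drev d); tail (phi (drev d))] by rewrite xE set22.
have E1 := tri_eq n3 n3' v1 v2.
have : [set tail (drev (phi d)); tail (drev d)] \in tri (drev d).
  by rewrite -E1 /tri (phi_tail (phi d)) (phi_tail d) !inE [X in _ || (X == _) || _]setUC eqxx orbT.
have xy := adj_neq (dart_adj d); have ya := @phi2_tail_neq (drev d).
have := @phi2_tail_neq d; rewrite phi_tail => xz.
rewrite /tri xE !inE => /orP [/orP []|] /eqP /eq_set2 [] [k1 k2] //.
- by case: xy; rewrite k2.
- by case: xy; rewrite k2.
- exact: (no_closing_corner h (esym k1)).
- by case: ya; rewrite -k2.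
Qed.

(** Both 4-faces are adjacent to the triangle, so they bound the same 4-cycle, and the edge of
    [phi d] again closes the corner at the head of [d]. *)
Lemma no_tri_quad_quad d : fsize d = 3 -> fsize (drev d) = 4 ->
  fsize (drev (phi d)) = 4 -> False.
Proof.
move=> n3 n4 n4'; have h := iter_fsize (drev d); rewrite n4 /= in h.
have xE : tail (phi (drev d)) = tail d by rewrite phi_tail drevK.
have yE : tail (phi (drev (phi d))) = tail (drev d) by rewrite phi_tail drevK phi_tail.
have xyQ : [set tail d; tail (drev d)] \in tri d :&: quad (drev d).
  by rewrite /tri /quad xE phi_tail !inE eqxx [[set tail (drev d); tail d]]setUC eqxx.
have yzQ : [set tail (drev (phi d)); tail (drev d)] \in tri d :&: quad (drev (phi d)).
  by rewrite /tri /quad yE (phi_tail (phi d)) (phi_tail d) !inE eqxx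
    [[set tail (drev d); tail (drev (phi d))]]setUC eqxx !orbT.
have E1 : quad (drev d) = quad (drev (phi d)).
  apply: (triangle_adj_at_most_one_4cycle (tri_face n3) (quad_face n4) (quad_face n4')).
    by apply/set0Pn; exists [set tail d; tail (drev d)].
  by apply/set0Pn; exists [set tail (drev (phi d)); tail (drev d)].
have : [set tail (drev (phi d)); tail (drev d)] \in quad (drev d).
  by rewrite E1; move: yzQ; rewrite inE => /andP [].
have xy := adj_neq (dart_adj d); have ya := @phi2_tail_neq (drev d).
have yb : tail (phi (phi (phi (drev d)))) <> tail (drev d).
  by have := adj_neq (adj_phi (phi (phi (phi (drev d))))); rewrite h.
have := @phi2_tail_neq d; rewrite phi_tail => xz.
rewrite /quad xE !inE => /orP [/orP [/orP []|]|] /eqP /eq_set2 [] [k1 k2] //.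
- by case: xy; rewrite k2.
- by case: xy; rewrite k2.
- by case: yb; rewrite k2.
- by case: ya; rewrite k2.
- exact: (no_closing_corner h (esym k1)).
- by case: yb; rewrite -k2.
Qed.

Definition gives (d : E * bool) : bool := (4 < fsize d) && (fsize (drev d) == 3).

(** All charges are doubled to stay in [nat]: a transferred half counts 1, and the target average 4
    becomes 8. *)
Lemma face_balance O : O \in porbits phi ->
  8 + \sum_(d in O) gives d <= 2 * #|O| + \sum_(d in O) gives (drev d).
Proof.
move=> /imsetP [x _ ->].
have sz d : d \in porbit phi x -> fsize d = fsize x.
  by rewrite /fsize -eq_porbit_mem => /eqP->.
have s1 := sum_porbit_shift phi x (fun d => gives d : nat).
have s2 := sum_porbit_shift phi x (fun d => gives (drev d) : nat).
have card1 : \sum_(d in porbit phi x) 1 = fsize x by rewrite sum1_card.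
have x3 := fsize_ge3 x; rewrite -/(fsize x).
have [x5|x4] := ltnP 4 (fsize x).
  (* Of two consecutive edges at most one gives, so a face gives across at most half of its edges;
     rounding down matters at length 5, where at most 2 edges give. *)
  have : \sum_(d in porbit phi x) (gives d + gives (phi d)) <= fsize x.
    rewrite -card1; apply: leq_sum => d dx.
    rewrite /gives; case: (eqVneq (fsize (drev d)) 3) => [a|_];
      case: (eqVneq (fsize (drev (phi d))) 3) => [b|_]; rewrite ?andbF ?addn0 ?leq_b1 //.
    by case: (no_tri_tri a b).
  by rewrite big_split /= s1; set b := \sum_(_ in _) _; lia.
have g0 : \sum_(d in porbit phi x) gives d = 0.
  by rewrite big1 // => d /sz dx; rewrite /gives dx ltnNge x4.
rewrite g0; case: (eqVneq (fsize x) 3) => [n3|n3]; last by lia.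
(* Of any two consecutive edges of the triangle at least one receives. Twice the number of receiving
   edges is thus at least 3, and by parity at least two edges receive. *)
have : 3 <= \sum_(d in porbit phi x) (gives (drev d) + gives (drev (phi d))).
  rewrite -n3 -card1; apply: leq_sum => d /sz dx; rewrite n3 in dx.
  have dx' : fsize (phi d) = 3 by rewrite fsize_phi.
  have big y : fsize y = 3 -> gives (drev y) = (fsize (drev y) != 4).
    move=> hy; rewrite /gives drevK hy eqxx andbT.
    have := fsize_ge3 (drev y); case: (eqVneq (fsize (drev y)) 3) => [k|]; last by lia.
    by case: (no_tri_rev_tri hy k).
  rewrite !big //; case: eqVneq => [a|_] //=; case: eqVneq => [b|_] //=.
  by case: (no_tri_quad_quad dx a b).
by rewrite big_split /= s2; set b := \sum_(_ in _) _; lia.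
Qed.

(** Summed over all faces, the transfers cancel under reversal of darts. *)
Lemma faces_le : 2 * #|porbits phi| <= #|E|.
Proof.
have : \sum_(O in porbits phi) (8 + \sum_(d in O) gives d) <=
       \sum_(O in porbits phi) (2 * #|O| + \sum_(d in O) gives (drev d)).
  by apply: leq_sum => O; apply: face_balance.
have cardO : \sum_(O in porbits phi) #|O| = 2 * #|E|.
  transitivity (\sum_(d : E * bool) 1).
    by rewrite -(sum_porbits phi); apply: eq_bigr => O _; rewrite sum1_card.
  by rewrite sum1_card card_prod card_bool mulnC.
have rev : \sum_d gives (drev d) = \sum_d gives d.
  by rewrite [RHS](reindex_inj (inv_inj drevK)).
rewrite 2!big_split /= (sum_porbits phi (fun d => gives d : nat)).
rewrite (sum_porbits phi (fun d => gives (drev d) : nat)) rev sum_nat_const.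
have -> : \sum_(O in porbits phi) 2 * #|O| = 2 * (2 * #|E|) by rewrite -cardO big_distrr.
rewrite leq_add2r => h; have {}h : #|porbits phi| * 8 <= 2 * (2 * #|E|) := h.
by move: h; move: #|porbits phi| #|E| => N m; lia.
Qed.

End Discharging.

(** * Induction over small edge cuts and conclusion *)

Lemma edges_bound (T : finType) (e : rel T) (S : {set T}) (F : {set {set T}}) :
  symmetric e -> irreflexive e -> planar e ->
  (forall C D : {set {set T}},
     is_triangle e C -> is_triangle e D -> C != D -> ~ intersecting_cycles C D) ->
  (forall C Q1 Q2 : {set {set T}},
     is_triangle e C -> is_4cycle e Q1 -> is_4cycle e Q2 ->
     adjacent_cycles C Q1 -> adjacent_cycles C Q2 -> Q1 = Q2) ->
  0 < #|S| -> F \subset edge_set e -> (forall f, f \in F -> f \subset S) ->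
  #|F| + 2 <= 2 * #|S|.
Proof.
move=> e_sym e_irr e_planar no_int adj1.
have [n] := ubnP #|S|; elim: n S F => // n ih S F Sn S0 Fe FS.
have ends f : f \in F -> exists xy : T * T, f = [set xy.1; xy.2] /\ e xy.1 xy.2.
  move/(subsetP Fe) => /imset2P [x y _]; rewrite inE => /andP [_ exy] ->.
  by exists (x, y).
pose cut (A : {set T}) := [set f in F | ~~ (f \subset A) & ~~ (f \subset S :\: A)].
(* The bounds of the two sides and the cut add up to [(2 * #|A| - 2) + (2 * #|S :\: A| - 2) + 2],
   which is again [2 * #|S| - 2]. *)
case: (boolP [exists A : {set T}, [&& A \proper S, A != set0 & #|cut A| <= 2]]).
  case/existsP => A /and3P [AS A0 cA].
  have sA : A \subset S by apply: proper_sub.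
  have cD : #|S :\: A| = #|S| - #|A| by rewrite cardsD (setIidPr sA).
  have ltA := proper_card AS; rewrite -card_gt0 in A0.
  pose FA := [set f in F | f \subset A]; pose FB := [set f in F | f \subset S :\: A].
  have hA : #|FA| + 2 <= 2 * #|A|.
    apply: ih => //; first by apply: leq_trans ltA _.
      by apply: subset_trans Fe; apply/subsetP => f; rewrite inE => /andP [].
    by move=> f; rewrite inE => /andP [].
  have hB : #|FB| + 2 <= 2 * #|S :\: A|.
    apply: ih; rewrite ?cD; try lia.
      by apply: subset_trans Fe; apply/subsetP => f; rewrite inE => /andP [].
    by move=> f; rewrite inE => /andP [].
  have FU : F \subset FA :|: FB :|: cut A.
    apply/subsetP => f fF; rewrite !inE fF /=.
    by case: (f \subset A); case: (f \subset S :\: A).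
  have := subset_leq_card FU; have := (leq_card_setU (FA :|: FB) (cut A)).1.
  have := (leq_card_setU FA FB).1; rewrite cD in hB.
  move: ltA cA hA hB; move: #|FA| #|FB| #|cut A| #|A| #|S| #|F| => a b k p q m.
  by lia.
rewrite negb_exists => /forallP noCut.
pose E : finType := {f : {set T} | f \in F}.
have cE : #|E| = #|F| by rewrite card_sig; apply: eq_card => f; rewrite inE.
have /indefinite_choice [xy hxy] : forall f : E, exists xy : T * T,
    val f = [set xy.1; xy.2] /\ e xy.1 xy.2.
  by move=> f; apply: ends; apply: valP.
pose src f := (xy f).1; pose tgt f := (xy f).2.
have st f : val f = [set src f; tgt f] by case: (hxy f).
have est f : e (src f) (tgt f) by case: (hxy f).
have npar f g : [set src f; tgt f] = [set src g; tgt g] -> f = g.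
  by rewrite -!st => /val_inj.
have srcS f : src f \in S by apply: (subsetP (FS _ (valP f))); rewrite st set21.
have tgtS f : tgt f \in S by apply: (subsetP (FS _ (valP f))); rewrite st set22.
have [phi [phi_tail phi_w]] := planar_map_of_planar e_irr est npar e_planar.
(* If every even set met [X] in an even number of edges, [X] would be a cut with at most two
   edges. *)
have sep (X : {set E}) : X != set0 -> #|X| <= 2 ->
    exists2 z, even_chain src tgt z & \big[addb/false]_(f in X) z f.
  move=> X0 X2; apply: NNPP => hn.
  have [z ez|A hA] := @cut_of_orthogonal _ _ src tgt S srcS tgtS X.
    by apply/negbTE/negP => h; apply: hn; exists z.
  (* [A] may reach outside [S], so it is intersected with [S]. An edge of [X] has exactly one end in
     [A], which makes [A :&: S] nonempty and proper. *)
  have cutX f : (val f \in cut (A :&: S)) = (f \in X).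
    rewrite hA inE (valP f) /= st !subUset !sub1set !inE !srcS !tgtS !andbT.
    by case: (src f \in A); case: (tgt f \in A).
  have := noCut (A :&: S); rewrite properE subsetIr andTb !negb_and !negbK -ltnNge.
  have [f fX] := set0Pn _ X0; have fst := hA f; rewrite fX in fst.
  case/or3P.
  - move=> sSA.
    have hs := subsetP sSA _ (srcS f); have ht := subsetP sSA _ (tgtS f).
    by move: hs ht; rewrite !inE => /andP [hs _] /andP [ht _]; rewrite hs ht in fst.
  - move=> /eqP /setP h0.
    have := h0 (src f); have := h0 (tgt f); rewrite !inE srcS tgtS !andbT.
    by move=> ht hs; rewrite hs ht in fst.
  - suff -> : cut (A :&: S) = val @: X.
      by rewrite card_imset ?ltnNge ?X2 //; apply: val_inj.
    apply/setP => g; apply/idP/imsetP => [gc|[k kX ->]]; last by rewrite cutX.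
    have gF : g \in F by move: gc; rewrite inE => /andP [].
    by exists (exist _ g gF) => //; rewrite -cutX.
have sep1 f : exists2 z, even_chain src tgt z & z f.
  have [||z ez] := sep [set f]; first by apply/set0Pn; exists f; rewrite inE.
    by rewrite cards1.
  by rewrite big_set1; exists z.
have sep2 f g : f <> g -> exists2 z, even_chain src tgt z & z f <> z g.
  move=> /eqP ne; have [||z ez] := sep [set f; g].
  - by apply/set0Pn; exists f; rewrite set21.
  - by rewrite cards2 ne.
  by rewrite big_setU1 ?inE //= big_set1 => h; exists z => // k; rewrite k addbb in h.
(* The Euler inequality needs an edge. With one, it combines with [faces_le] to
   [#|F| + 4 <= 2 * #|S|]. *)
have [F0|F0] := posnP #|F|; first by rewrite F0; lia.
have := faces_le e_sym e_irr est npar no_int adj1 phi_tail phi_w sep1 sep2.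
have := faces_bound srcS tgtS S0 _ phi_w; rewrite cE => /(_ F0).
by lia.
Qed.

Theorem theorem2 (T : finType) (e : rel T)
  (e_sym : symmetric e) (e_irr : irreflexive e)
  (e_planar : planar e)
  (no_intersecting_triangles : forall C D : {set {set T}},
      is_triangle e C -> is_triangle e D -> C != D ->
      ~ intersecting_cycles C D)
  (triangle_adj_at_most_one_4cycle : forall C Q1 Q2 : {set {set T}},
      is_triangle e C -> is_4cycle e Q1 -> is_4cycle e Q2 ->
      adjacent_cycles C Q1 -> adjacent_cycles C Q2 -> Q1 = Q2) :
  mad_lt e 4.
Proof.
move=> S F S0 Fe FS.
have := edges_bound e_sym e_irr e_planar no_intersecting_triangles
  triangle_adj_at_most_one_4cycle S0 Fe FS.
by lia.
Qed.
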